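(* Let $m,n\ge 2$ be integers, let $\mathcal{A}\in\mathbb{R}^{[m,n]}$ be a symmetric tensor, let $(\lambda,x)\in\mathbb{R}\times\mathbb{R}^n$ be a $Z$-eigenpair of $\mathcal{A}$, and let $\alpha\in\mathbb{R}$. Assume that either $\alpha>\beta(\mathcal{A})$ and $(\lambda,x)$ is negative stable, or $\alpha<-\beta(\mathcal{A})$ and $(\lambda,x)$ is positive stable. Let $$J=J(x;\alpha)=\frac{(m-1)(\mathcal{A}x^{m-2}-\lambda xx^T)+\alpha(I-xx^T)}{\lambda+\alpha}\in\mathbb{R}^{n\times n},$$ let $\rho$ be the spectral radius of $J$, and for $\gamma\in\mathbb{R}$ let $$J_\gamma=\begin{pmatrix}(1-\gamma)J & \gamma J\\ I_n & 0_n\end{pmatrix}\in\mathbb{R}^{2n\times 2n},$$ with spectral radius $\rho_\gamma$. Set $$\gamma_{opt}=\frac{(\rho-2)+2\sqrt{1-\rho}}{\rho}.$$ Then for every $\gamma\in[\gamma_{opt},0]$, $$\rho_\gamma=\frac{(1-\gamma)\rho+\sqrt{((1-\gamma)\rho)^2+4\gamma\rho}}{2}.$$ Moreover, $\gamma_{opt}$ is the value of $\gamma\in\mathbb{R}$ that minimizes the spectral radius $\rho_\gamma$ of $J_\gamma$, and the resulting minimal spectral radius is $\rho_{opt}=\rho_{\gamma_{opt}}=1-\sqrt{1-\rho}$.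
   Context: A real tensor $\mathcal{A}\in\mathbb{R}^{[m,n]}$ of order $m$ and dimension $n$ is an array of real entries $a_{i_1\dots i_m}$, $i_j\in\{1,\dots,n\}$. It is symmetric if its entries are invariant under all permutations of the indices. For $x\in\mathbb{R}^n$ and $r\in\{0,\dots,m-1\}$, $\mathcal{A}x^{m-r}$ is the order-$r$ tensor with entries $(\mathcal{A}x^{m-r})_{i_1,\dots,i_r}=\sum_{i_{r+1},\dots,i_m}a_{i_1\dots i_m}x_{i_{r+1}}\cdots x_{i_m}$; in particular $\mathcal{A}x^{m-1}$ is a vector and $\mathcal{A}x^{m-2}$ is a symmetric $n\times n$ matrix (for $m=2$, $\mathcal{A}x^{0}$ is the matrix $\mathcal{A}$ itself). A $Z$-eigenpair of $\mathcal{A}$ is $(\lambda,x)\in\mathbb{R}\times\mathbb{R}^n$ with $\mathcal{A}x^{m-1}=\lambda x$ and $x^Tx=1$. With $\Sigma=\{x\in\mathbb{R}^n: x^Tx=1\}$ and $\rho(\cdot)$ the spectral radius (maximal magnitude of the eigenvalues) of a matrix, $\beta(\mathcal{A})=(m-1)\max_{x\in\Sigma}\rho(\mathcal{A}x^{m-2})$. For a $Z$-eigenpair $(\lambda,x)$ let $U\in\mathbb{R}^{n\times(n-1)}$ have columns forming an orthonormal basis of $x^\perp=\{y\in\mathbb{R}^n:y^Tx=0\}$ and let $C(\lambda,x)=U^T((m-1)\mathcal{A}x^{m-2}-\lambda I)U\in\mathbb{R}^{(n-1)\times(n-1)}$; the eigenpair is positive stable if $C(\lambda,x)$ is positive definite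 and negative stable if $C(\lambda,x)$ is negative definite. $I_n$ and $0_n$ are the $n\times n$ identity and zero matrices. *)

(* Defs.v *)
From mathcomp Require Import all_boot all_order all_algebra all_fingroup.
From mathcomp Require Import classical_sets reals complex.

Set Implicit Arguments.
Unset Strict Implicit.
Unset Printing Implicit Defensive.

Import Order.TTheory GRing.Theory Num.Theory.
Local Open Scope classical_set_scope.
Local Open Scope ring_scope.

Definition tensor (R : realType) (m n : nat) : Type := m.-tuple 'I_n -> R.

Definition symmetric_tensor (R : realType) (m n : nat) (A : tensor R m n) :
    Prop :=
  forall (s : 'S_m) (t : m.-tuple 'I_n),
    A [tuple tnth t (s k) | k < m] = A t.

(* [@contract R m n A x r] is A x^(m-r), for r <= m: the tuples t whose
   first r entries are fixed to i are the (i_1, ..., i_r, i_(r+1), ..., i_m)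
   with i_(r+1), ..., i_m free.  Indices start at 0, so that the positions
   r+1, ..., m are the k : 'I_m with r <= k. *)
Definition contract (R : realType) (m n : nat) (A : tensor R m n)
    (x : 'cV[R]_n) (r : nat) : tensor R r n :=
  fun i => \sum_(t : m.-tuple 'I_n | take r t == i)
             A t * \prod_(k < m | (r <= k)%N) x (tnth t k) 0.

Definition contract_vec (R : realType) (m n : nat) (A : tensor R m n)
    (x : 'cV[R]_n) : 'cV[R]_n :=
  \col_i contract A x [tuple i].

Definition contract_mx (R : realType) (m n : nat) (A : tensor R m n)
    (x : 'cV[R]_n) : 'M[R]_n :=
  \matrix_(i, j) contract A x [tuple i; j].

Definition unit_sphere (R : realType) (n : nat) : set 'cV[R]_n :=
  [set x | x^T *m x = 1%:M].

Definition Z_eigenpair (R : realType) (m n : nat) (A : tensor R m n)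
    (lambda : R) (x : 'cV[R]_n) : Prop :=
  contract_vec A x = lambda *: x /\ x^T *m x = 1%:M.

(* All complex eigenvalues count, since the matrix need not be symmetric.  For
   0 < n their set is finite and nonempty, so the supremum is a maximum. *)
Definition spectral_radius (R : realType) (n : nat) (M : 'M[R]_n) : R :=
  sup [set Normc.normc z | z in
        [set z : R[i] | eigenvalue (map_mx (real_complex R) M) z]].

(* For 0 < n the sphere is compact and nonempty and the spectral radius is
   continuous, so the supremum is a maximum. *)
Definition beta (R : realType) (m n : nat) (A : tensor R m n) : R :=
  (m - 1)%:R *
  sup [set spectral_radius (contract_mx A x) | x in @unit_sphere R n].

(* The row space of U^T is the span of the columns of U, and [kermx x] is the
   space of the row vectors v such that v *m x = 0. *)
Definition orthonormal_basis_of_perp (R : realType) (n : nat) (x : 'cV[R]_n)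
    (U : 'M[R]_(n, n - 1)) : Prop :=
  U^T *m U = 1%:M /\ (U^T == kermx x)%MS.

Definition projected_hessian (R : realType) (m n : nat) (A : tensor R m n)
    (lambda : R) (x : 'cV[R]_n) (U : 'M[R]_(n, n - 1)) : 'M[R]_(n - 1) :=
  U^T *m ((m - 1)%:R *: contract_mx A x - lambda%:M) *m U.

Definition positive_definite (R : realType) (n : nat) (M : 'M[R]_n) : Prop :=
  forall y : 'cV[R]_n, y != 0 -> 0 < (y^T *m M *m y) 0 0.

Definition negative_definite (R : realType) (n : nat) (M : 'M[R]_n) : Prop :=
  forall y : 'cV[R]_n, y != 0 -> (y^T *m M *m y) 0 0 < 0.

(* Definiteness does not depend on the choice of U: two orthonormal bases of
   the orthogonal complement of x give orthogonally similar matrices. *)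
Definition positive_stable (R : realType) (m n : nat) (A : tensor R m n)
    (lambda : R) (x : 'cV[R]_n) : Prop :=
  exists2 U, orthonormal_basis_of_perp x U &
    positive_definite (projected_hessian A lambda x U).

Definition negative_stable (R : realType) (m n : nat) (A : tensor R m n)
    (lambda : R) (x : 'cV[R]_n) : Prop :=
  exists2 U, orthonormal_basis_of_perp x U &
    negative_definite (projected_hessian A lambda x U).

Definition jacobian (R : realType) (m n : nat) (A : tensor R m n)
    (lambda : R) (x : 'cV[R]_n) (alpha : R) : 'M[R]_n :=
  (lambda + alpha)^-1 *:
    ((m - 1)%:R *: (contract_mx A x - lambda *: (x *m x^T))
     + alpha *: (1%:M - x *m x^T)).

Definition extrapolated_jacobian (R : realType) (n : nat) (J : 'M[R]_n)
    (gamma : R) : 'M[R]_(n + n) :=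
  block_mx ((1 - gamma) *: J) (gamma *: J) 1%:M 0.

(* Main.v *)
Require Import Defs.
From mathcomp Require Import all_boot all_order all_algebra all_fingroup.
From mathcomp Require Import classical_sets reals complex.
From mathcomp Require Import ring lra.

(** Write [J] for the Jacobian, [M] for the matrix A x^(m-2) and [H] for
    (m-1) M.  Since the tensor is symmetric, [M] is a symmetric matrix with
    M x = lambda x; hence [J] is symmetric and J x = 0, while on the orthogonal
    complement of [x] it acts as (H + alpha) / (lambda + alpha).  An eigenvalue
    mu of [H] with an eigenvector orthogonal to [x] satisfies |mu| <= beta and
    |lambda| <= beta ([eigenvalue_le_beta]), and stability places it on a
    definite side of lambda.  Under either hypothesis this says that
    (mu + alpha) / (lambda + alpha) lies strictly between 0 and 1
    ([perp_eigenvalue_stable]).  So the spectrum of [J] is real and contained in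
    [0, 1), and as [x] has a nonzero orthogonal complement it contains a
    positive number; its spectral radius [rho] is therefore an eigenvalue and
    0 < rho < 1.

    The rest uses only this information ([optimal_extrapolation]).  The
    eigenvalues eta of the extrapolated matrix are the roots of
    eta^2 = sigma ((1 - gamma) eta + gamma), with sigma in the spectrum of [J].
    Put s = sqrt (1 - rho), so that rho = (1 - s)(1 + s) and
    gamma_opt = - (1 - s) / (1 + s).

    - If gamma_opt <= gamma <= 0, the equation for sigma = rho has real roots,
      and the larger one bounds the modulus of every root of every equation
      with 0 <= sigma <= rho ([quadratic_root_norm_le]).  At gamma_opt its
      discriminant vanishes and the double root is 1 - s.
    - If gamma < gamma_opt, the two roots for sigma = rho have product
      - gamma rho > - gamma_opt rho = (1 - s)^2, so that one of them has modulus
      greater than 1 - s ([sqr_spectral_radius_ge]).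
    - If gamma > gamma_opt, the monic quadratic for sigma = rho is negative at
      1 - s, so it has a real root greater than 1 - s. *)

Set Implicit Arguments.
Unset Strict Implicit.
Unset Printing Implicit Defensive.

Import Order.TTheory GRing.Theory Num.Theory.
Local Open Scope ring_scope.

(** * The spectral radius of a real matrix *)

Lemma normc_normr (R : realType) (z : R[i]) : (Normc.normc z)%:C%C = `|z|.
Proof. by rewrite normc_def; case: z. Qed.

Lemma normc_ge0 (R : realType) (z : R[i]) : 0 <= Normc.normc z.
Proof. by case: z => a b; apply: sqrtr_ge0. Qed.

Lemma le_normcR (R : realType) (z : R[i]) (b : R) :
  (Normc.normc z <= b) = (`|z| <= b%:C%C).
Proof. by rewrite -normc_normr lecR. Qed.

Lemma normc_real (R : realType) (a : R) : Normc.normc (a%:C)%C = `|a|.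
Proof. by rewrite /= expr0n addr0 sqrtr_sqr. Qed.

(** Taking the 1-norm of both sides of v M = z v and dividing by that of v.
    The bound is crude, but uniform as M ranges over matrices with bounded
    entries, which makes the suprema in the spectral radius and in beta
    suprema of bounded sets. *)
Lemma eigenvalue_sum_norm (C : numFieldType) (n : nat) (M : 'M[C]_n) (z : C) :
  eigenvalue M z -> `|z| <= \sum_i \sum_j `|M i j|.
Proof.
case/eigenvalueP => v vM v0; set S := \sum_i _.
have [k vk] : exists k, v 0 k != 0.
  apply/existsP; apply: contraR v0 => /existsPn v0.
  by apply/eqP/rowP => k; rewrite mxE; apply/eqP; move: (v0 k); rewrite negbK.
have vpos : 0 < \sum_j `|v 0 j|.
  rewrite (bigD1 k) //= ltr_pwDl ?normr_gt0 ?sumr_ge0 //.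
rewrite -(ler_pM2r vpos) mulr_sumr.
have -> : \sum_j `|z| * `|v 0 j| = \sum_j `|\sum_i v 0 i * M i j|.
  apply: eq_bigr => j _; rewrite -normrM.
  by move/rowP: vM => /(_ j); rewrite !mxE => ->.
apply: (@le_trans _ _ (\sum_j \sum_i `|v 0 i| * `|M i j|)).
  apply: ler_sum => j _; apply: (le_trans (ler_norm_sum _ _ _)).
  by apply: ler_sum => i _; rewrite normrM.
rewrite exchange_big /= /S mulr_suml; apply: ler_sum => i _.
rewrite -mulr_sumr mulrC; apply: ler_wpM2l; first exact: sumr_ge0.
by rewrite (bigD1 i) //= lerDl sumr_ge0.
Qed.

Section SpectralRadius.
Variables (R : realType) (n : nat) (M : 'M[R]_n).
Let MC := map_mx (real_complex R) M.

Lemma eigenvalue_normc_le_entries (z : R[i]) :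
  eigenvalue MC z -> Normc.normc z <= \sum_i \sum_j `|M i j|.
Proof.
move=> /eigenvalue_sum_norm; rewrite le_normcR => /le_trans; apply.
rewrite rmorph_sum; apply: ler_sum => i _ /=; rewrite rmorph_sum.
by apply: ler_sum => j _; rewrite /= mxE -normc_normr normc_real.
Qed.

Lemma normc_le_spectral_radius (z : R[i]) :
  eigenvalue MC z -> Normc.normc z <= spectral_radius M.
Proof.
move=> ev; apply: ub_le_sup; last by exists z.
exists (\sum_i \sum_j `|M i j|) => _ [y ev' <-].
exact: eigenvalue_normc_le_entries.
Qed.

Lemma real_le_spectral_radius (a : R) :
  eigenvalue M a -> `|a| <= spectral_radius M.
Proof.
by rewrite -normc_real -(eigenvalue_map (real_complex R)) => /normc_le_spectral_radius.
Qed.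

Hypothesis n_gt0 : (0 < n)%N.

Lemma spectral_radius_le (b : R) :
  (forall z, eigenvalue MC z -> Normc.normc z <= b) -> spectral_radius M <= b.
Proof.
move=> h; apply: ge_sup => [|_ [z ev <-]]; last exact: h.
by have [z ev] := eigenvalue_closed MC n_gt0; exists (Normc.normc z), z.
Qed.

(** The spectrum is the set of roots of the characteristic polynomial, which
    splits over the complex numbers: the maximum is over a finite list. *)
Lemma spectral_radius_attained :
  exists2 z, eigenvalue MC z & Normc.normc z = spectral_radius M.
Proof.
have [rs Ers] := closed_field_poly_normal (char_poly MC).
have evE z : eigenvalue MC z = (z \in rs).
  rewrite eigenvalue_root_char Ers (monicP (char_poly_monic _)) scale1r.
  exact: root_prod_XsubC.
have [z0 ev0] := eigenvalue_closed MC n_gt0.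
rewrite evE in ev0.
have i0 : 'I_(size rs) by apply: (@Ordinal _ (index z0 rs)); rewrite index_mem.
have [i _ imax] := @arg_maxP _ _ _ i0 predT (fun i => Normc.normc (rs`_i)) isT.
have evi : eigenvalue MC rs`_i by rewrite evE mem_nth.
exists rs`_i => //; apply/le_anti; rewrite normc_le_spectral_radius //=.
apply: spectral_radius_le => z; rewrite evE => zrs.
have zlt : (index z rs < size rs)%N by rewrite index_mem.
by have := imax (Ordinal zlt) isT; rewrite /= nth_index.
Qed.

Lemma spectral_radius_ge0 : 0 <= spectral_radius M.
Proof. by have [z _ <-] := spectral_radius_attained; exact: normc_ge0. Qed.

End SpectralRadius.

(** * Real symmetric matrices *)

Lemma dotmx_ge0 (R : realDomainType) (n : nat) (v : 'rV[R]_n) :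
  0 <= (v *m v^T) 0 0.
Proof. by rewrite mxE sumr_ge0 // => i _; rewrite mxE -expr2 sqr_ge0. Qed.

Lemma dotmx_eq0 (R : realDomainType) (n : nat) (v : 'rV[R]_n) :
  ((v *m v^T) 0 0 == 0) = (v == 0).
Proof.
apply/idP/eqP => [|->]; last by rewrite mul0mx mxE.
rewrite mxE psumr_eq0 => [/allP h|i _]; last by rewrite mxE -expr2 sqr_ge0.
apply/rowP => i; move: (h i); rewrite mem_index_enum !mxE mulf_eq0 orbb.
by move=> /(_ isT)/eqP.
Qed.

(** With z = a + i b and v = p + i q, the equation v S = z v splits into
    p S = a p - b q and q S = a q + b p.  Symmetry of S equates p S q^T with
    q S p^T, which leaves b (|p|^2 + |q|^2) = 0. *)
Lemma symmetric_eigenvalue_real (R : realType) (n : nat) (S : 'M[R]_n)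
    (z : R[i]) : S^T = S -> eigenvalue (map_mx (real_complex R) S) z ->
  exists2 a : R, z = (a%:C)%C & eigenvalue S a.
Proof.
move=> symS ev; suff imz : z = (complex.Re z)%:C%C.
  exists (complex.Re z) => //.
  by move: ev; rewrite {1}imz (eigenvalue_map (real_complex R)).
have [v vS v0] := eigenvalueP ev; case: z vS {ev} => a b vS; congr (_ +i* _)%C.
pose p : 'rV[R]_n := map_mx (@complex.Re R) v; pose q : 'rV[R]_n := map_mx (@complex.Im R) v.
have vE j : v 0 j = (p 0 j +i* q 0 j)%C by rewrite !mxE; case: (v 0 j).
have vSE j : (v *m map_mx (real_complex R) S) 0 j
    = ((p *m S) 0 j +i* (q *m S) 0 j)%C.
  rewrite !mxE (complexE (_ +i* _)%C) /= !rmorph_sum mulr_sumr -big_split /=.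
  apply: eq_bigr => i _; rewrite vE [map_mx (real_complex R) S _ _]mxE.
  by apply/eqP; rewrite eq_complex; simpc.
have pS : p *m S = a *: p - b *: q.
  apply/rowP => j; have /rowP/(_ j) := vS; rewrite vSE.
  by rewrite [(_ *: v) _ _]mxE vE; simpc => -[-> _]; rewrite !mxE.
have qS : q *m S = a *: q + b *: p.
  apply/rowP => j; have /rowP/(_ j) := vS; rewrite vSE.
  by rewrite [(_ *: v) _ _]mxE vE; simpc => -[_ ->]; rewrite !mxE.
have Epq : (p *m S *m q^T) 0 0 = (q *m S *m p^T) 0 0.
  have -> : q *m S *m p^T = (p *m S *m q^T)^T.
    by rewrite !trmx_mul trmxK symS mulmxA.
  by rewrite [RHS]mxE.
have Eqp : (p *m q^T) 0 0 = (q *m p^T) 0 0.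
  have -> : q *m p^T = (p *m q^T)^T by rewrite trmx_mul trmxK.
  by rewrite [RHS]mxE.
have : b * ((p *m p^T) 0 0 + (q *m q^T) 0 0) = 0.
  move: Epq; rewrite pS qS !mulmxDl mulNmx -!scalemxAl.
  by rewrite ![(_ + _ : matrix _ _ _) _ _]mxE ![(- _ : matrix _ _ _) _ _]mxE
    ![(_ *: _ : matrix _ _ _) _ _]mxE Eqp; lra.
move=> /eqP; rewrite mulf_eq0 => /orP[/eqP //|].
rewrite paddr_eq0 ?dotmx_ge0 // !dotmx_eq0 => /andP[/eqP p0 /eqP q0].
by case/eqP: v0; apply/rowP => j; rewrite vE p0 q0 !mxE.
Qed.

(** * The spectrum of the extrapolated matrix *)

(** If a J = sigma a, the row vector (a, (eta - (1 - gamma) sigma) a) is an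
    eigenvector: the second block is forced by the first block equation, and
    the second block equation is then the quadratic equation for eta. *)
Lemma eigenvalue_extrapolated (R : realType) (n : nat) (J : 'M[R]_n)
    (gamma : R) (sigma eta : R[i]) :
  eigenvalue (map_mx (real_complex R) J) sigma ->
  eta ^+ 2 = sigma * ((1 - gamma)%:C%C * eta + gamma%:C%C) ->
  eigenvalue (map_mx (real_complex R) (extrapolated_jacobian J gamma)) eta.
Proof.
move=> /eigenvalueP[a aJ a0] eqn.
apply/eigenvalueP; exists (row_mx a ((eta - (1 - gamma)%:C%C * sigma) *: a)).
  rewrite map_block_mx mul_row_block !map_mxZ map_mx1 map_mx0 mulmx0 addr0.
  rewrite mulmx1 scale_row_mx -!scalemxAr aJ !scalerA -scalerDl.
  congr row_mx; congr (_ *: _); first by ring.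
  rewrite mulrBr -expr2 eqn; ring.
by rewrite -row_mx0; apply: contra a0 => /eqP/eq_row_mx[-> _].
Qed.

(** For an eigenvector (a, b), eliminating b from the two block equations gives
    ((1 - gamma) eta + gamma) a J = eta^2 a. *)
Lemma extrapolated_eigenvalue (R : realType) (n : nat) (J : 'M[R]_n)
    (gamma : R) (eta : R[i]) : (0 < n)%N ->
  eigenvalue (map_mx (real_complex R) (extrapolated_jacobian J gamma)) eta ->
  exists2 sigma, eigenvalue (map_mx (real_complex R) J) sigma &
    eta ^+ 2 = sigma * ((1 - gamma)%:C%C * eta + gamma%:C%C).
Proof.
move=> n_gt0 /eigenvalueP[v + v0].
rewrite -[v]hsubmxK in v0 *; move: (lsubmx v) (rsubmx v) v0 => a b v0.
rewrite map_block_mx mul_row_block !map_mxZ map_mx1 map_mx0 mulmx0 addr0.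
rewrite mulmx1 scale_row_mx -!scalemxAr; set JC := map_mx _ J.
move=> /eq_row_mx[ea eb]; set d := _ + _.
have key : d *: (a *m JC) = eta ^+ 2 *: a.
  rewrite expr2 -scalerA -ea scalerDr -eb !scalerA -scalerDl.
  by congr (_ *: _); rewrite /d; ring.
have a0 : a != 0.
  apply: contraNneq v0 => a0; move: ea; rewrite a0 mul0mx !scaler0 add0r => ->.
  by rewrite row_mx0.
(* When the factor of a J vanishes, so does eta, and every sigma works. *)
have [d0|d0] := eqVneq d 0.
  have [s ev] := eigenvalue_closed JC n_gt0; exists s => //.
  rewrite d0 mulr0; move/eqP: key.
  by rewrite d0 scale0r eq_sym scaler_eq0 (negPf a0) orbF => /eqP.
exists (eta ^+ 2 / d); last by rewrite mulfVK.
apply/eigenvalueP; exists a => //.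
by rewrite mulrC -scalerA -key scalerA mulVf // scale1r.
Qed.

(** * The optimal extrapolation parameter *)

(** The larger root of E^2 = rho ((1 - gamma) E + gamma) when the discriminant
    is nonnegative. *)
Definition extrapolated_radius (R : rcfType) (gamma rho : R) : R :=
  ((1 - gamma) * rho + Num.sqrt (((1 - gamma) * rho) ^+ 2 + 4 * gamma * rho))
    / 2.

Lemma extrapolated_radius_root (R : rcfType) (gamma rho : R) :
  0 <= ((1 - gamma) * rho) ^+ 2 + 4 * gamma * rho ->
  let E := extrapolated_radius gamma rho in
  E ^+ 2 = rho * ((1 - gamma) * E + gamma).
Proof.
move=> D0; rewrite /extrapolated_radius; set D := _ + _ in D0 *.
have := sqr_sqrtr D0; set r := Num.sqrt D => hr.
have e : 4 * (((1 - gamma) * rho + r) / 2) ^+ 2 =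
  ((1 - gamma) * rho) ^+ 2 + 2 * ((1 - gamma) * rho) * r + r ^+ 2 by field.
apply: (@mulfI _ 4); rewrite ?pnatr_eq0 // e hr /D; by field.
Qed.

(** A nonreal root has squared modulus - gamma sigma, the product of the two
    conjugate roots, and this is at most - gamma rho <= E^2.  A positive real
    root u > E would satisfy u^2 = sigma ((1 - gamma) u + gamma)
    <= rho ((1 - gamma) u + gamma) < u^2, since E is the larger root of the
    quadratic with rho.  A real root u <= 0 makes (1 - gamma) u + gamma
    nonpositive, hence u^2 <= 0 and u = 0. *)
Lemma quadratic_root_norm_le (R : realType) (gamma rho sigma : R)
    (eta : R[i]) : 0 <= sigma <= rho -> gamma <= 0 ->
  0 <= ((1 - gamma) * rho) ^+ 2 + 4 * gamma * rho ->
  eta ^+ 2 = sigma%:C%C * ((1 - gamma)%:C%C * eta + gamma%:C%C) ->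
  Normc.normc eta <= extrapolated_radius gamma rho.
Proof.
move=> /andP[s0 sr] g0 D0; have /= Eroot := extrapolated_radius_root D0.
have bE : (1 - gamma) * rho <= 2 * extrapolated_radius gamma rho.
  have := sqrtr_ge0 (((1 - gamma) * rho) ^+ 2 + 4 * gamma * rho).
  rewrite /extrapolated_radius; lra.
set E := extrapolated_radius gamma rho in Eroot bE *.
have b0 : 0 <= (1 - gamma) * rho by apply: mulr_ge0; lra.
have E0 : 0 <= E by lra.
case: eta => u v /eqP; rewrite expr2 eq_complex; simpc => /andP[/eqP/= re /eqP/= im].
rewrite -(ler_pXn2r (n:=2)) ?nnegrE ?sqrtr_ge0 // sqr_sqrtr; last first.
  by rewrite addr_ge0 ?sqr_ge0.
have [v0|v0] := eqVneq v 0.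
  rewrite v0 in re *.
  have re' : u ^+ 2 = sigma * ((1 - gamma) * u + gamma) by lra.
  rewrite expr0n addr0.
  have [c0|c0] := lerP ((1 - gamma) * u + gamma) 0.
    have : u ^+ 2 <= 0 by rewrite re'; nra.
    by move=> /le_trans; apply; rewrite sqr_ge0.
  have u0 : 0 < u by nra.
  rewrite ler_pXn2r ?nnegrE // ?(ltW u0) //; rewrite leNgt; apply/negP => uE.
  have : u ^+ 2 <= rho * ((1 - gamma) * u + gamma) by rewrite re'; nra.
  have : (u - E) * (u + E - (1 - gamma) * rho) > 0 by apply: mulr_gt0; lra.
  nra.
(* The imaginary part of the equation is v (2 u - (1 - gamma) sigma) = 0. *)
have u2 : 2 * u = (1 - gamma) * sigma by apply: (mulIf v0); lra.
have -> : u ^+ 2 + v ^+ 2 = - gamma * sigma by nra.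
have : - gamma * sigma <= - gamma * rho by nra.
(* The smaller root is (1 - gamma) rho - E, so E^2 >= - gamma rho. *)
have : E * (2 * E - (1 - gamma) * rho) >= 0 by apply: mulr_ge0; lra.
nra.
Qed.

Section LowerBounds.
Variables (R : realType) (n : nat) (J : 'M[R]_n) (rho : R).
Hypothesis rhoJ : eigenvalue J rho.

Lemma extrapolated_radius_le_spectral_radius (gamma : R) :
  0 <= ((1 - gamma) * rho) ^+ 2 + 4 * gamma * rho ->
  extrapolated_radius gamma rho
    <= spectral_radius (extrapolated_jacobian J gamma).
Proof.
move=> D0; apply: (le_trans (ler_norm _)); rewrite -normc_real.
apply: normc_le_spectral_radius.
apply: (@eigenvalue_extrapolated _ _ _ _ (rho%:C)%C).
  by rewrite (eigenvalue_map (real_complex R)).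
have /(congr1 (real_complex R)) := extrapolated_radius_root D0.
by rewrite !(rmorphXn, rmorphM, rmorphD).
Qed.

(** The two roots of the quadratic for rho, whatever the sign of its
    discriminant, have product - gamma rho and are both eigenvalues. *)
Lemma sqr_spectral_radius_ge (gamma : R) :
  - gamma * rho <= spectral_radius (extrapolated_jacobian J gamma) ^+ 2.
Proof.
set b : R[i] := (((1 - gamma) * rho)%:C)%C.
set r : R[i] := sqrtc ((((1 - gamma) * rho) ^+ 2 + 4 * gamma * rho)%:C)%C.
have r2 : r ^+ 2 = b ^+ 2 + 4 * gamma%:C%C * rho%:C%C.
  by rewrite sqr_sqrtc /b !(rmorphXn, rmorphM, rmorphD, rmorph_nat).
have two0 : (2 : R[i]) != 0 by rewrite pnatr_eq0.
have root e : e ^+ 2 = r ^+ 2 ->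
    Normc.normc ((b + e) / 2) <= spectral_radius (extrapolated_jacobian J gamma).
  move=> e2; apply: normc_le_spectral_radius.
  apply: (@eigenvalue_extrapolated _ _ _ _ (rho%:C)%C).
    by rewrite (eigenvalue_map (real_complex R)).
  apply: (@mulfI _ 4); rewrite ?pnatr_eq0 //.
  have -> : 4 * ((b + e) / 2) ^+ 2 = b ^+ 2 + 2 * b * e + e ^+ 2 by field.
  rewrite e2 r2 /b rmorphM; by field.
have h1 := root r erefl; have h2 := root (- r) (sqrrN r).
have prod : (b + r) / 2 * ((b + - r) / 2) = ((- gamma * rho)%:C)%C.
  have -> : (b + r) / 2 * ((b + - r) / 2) = (b ^+ 2 - r ^+ 2) / 4 by field.
  rewrite r2 rmorphM rmorphN; by field.
apply: (le_trans (ler_norm _)); rewrite -normc_real -prod Normc.normcM expr2.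
by apply: ler_pM => //; apply: normc_ge0.
Qed.

End LowerBounds.

Lemma extrapolated_spectral_radius (R : realType) (n : nat) (J : 'M[R]_n)
    (rho gamma : R) : (0 < n)%N -> eigenvalue J rho ->
  (forall z, eigenvalue (map_mx (real_complex R) J) z ->
     exists2 sigma : R, 0 <= sigma <= rho & z = (sigma%:C)%C) ->
  gamma <= 0 -> 0 <= ((1 - gamma) * rho) ^+ 2 + 4 * gamma * rho ->
  spectral_radius (extrapolated_jacobian J gamma)
    = extrapolated_radius gamma rho.
Proof.
move=> n_gt0 rhoJ spec g0 D0; apply/le_anti.
rewrite extrapolated_radius_le_spectral_radius // andbT.
apply: spectral_radius_le => [|eta]; first by rewrite addn_gt0 n_gt0.
case/(extrapolated_eigenvalue n_gt0) => z /spec[sigma sb ->].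
exact: quadratic_root_norm_le.
Qed.

Lemma optimal_extrapolation (R : realType) (n : nat) (J : 'M[R]_n)
    (rho : R) : (0 < n)%N -> 0 < rho < 1 -> eigenvalue J rho ->
  (forall z, eigenvalue (map_mx (real_complex R) J) z ->
     exists2 sigma : R, 0 <= sigma <= rho & z = (sigma%:C)%C) ->
  let rho_ := fun gamma : R => spectral_radius (extrapolated_jacobian J gamma) in
  let gamma_opt := ((rho - 2) + 2 * Num.sqrt (1 - rho)) / rho in
  [/\ forall gamma : R, gamma_opt <= gamma <= 0 ->
        rho_ gamma = extrapolated_radius gamma rho,
      forall gamma : R, gamma != gamma_opt -> rho_ gamma_opt < rho_ gamma
    & rho_ gamma_opt = 1 - Num.sqrt (1 - rho)].
Proof.
move=> n_gt0 /andP[rho0 rho1] rhoJ spec rho_ gamma_opt.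
have s2 : Num.sqrt (1 - rho) ^+ 2 = 1 - rho by rewrite sqr_sqrtr ?subr_ge0 ?ltW.
have s0 : 0 < Num.sqrt (1 - rho) by rewrite sqrtr_gt0 subr_gt0.
rewrite {}/gamma_opt; move: (Num.sqrt (1 - rho)) s0 s2 => s s0 s2.
have rhoE : rho = (1 - s) * (1 + s) by lra.
have s1 : s < 1 by nra.
have s1' : 1 + s != 0 by lra.
have s1'' : 1 - s != 0 by lra.
have -> : (rho - 2 + 2 * s) / rho = - (1 - s) / (1 + s).
  by rewrite rhoE; field; rewrite s1' s1''.
set g := - (1 - s) / (1 + s).
have gE : g * (1 + s) = - (1 - s) by rewrite /g mulfVK.
have g0 : g <= 0 by nra.
(* If p is the monic quadratic for rho with linear coefficient - b, its
   discriminant is (2 t - b)^2 - 4 p(t); here t = 1 - s, for which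
   p(t) = - s (1 - s) (1 + s) (gamma - gamma_opt). *)
have key gamma : ((1 - gamma) * rho) ^+ 2 + 4 * gamma * rho
    = (2 * (1 - s) - (1 - gamma) * rho) ^+ 2
      + 4 * (s * (1 - s)) * ((1 + s) * (gamma - g)).
  have -> : (1 + s) * (gamma - g) = gamma * (1 + s) + (1 - s) by lra.
  rewrite rhoE; ring.
have ss : 0 < 4 * (s * (1 - s)) by rewrite !mulr_gt0 //; lra.
have D_ge0 gamma : g <= gamma ->
    0 <= ((1 - gamma) * rho) ^+ 2 + 4 * gamma * rho.
  move=> gg; rewrite key addr_ge0 ?sqr_ge0 // mulr_ge0 ?(ltW ss) //.
  by apply: mulr_ge0; lra.
have part1 gamma : g <= gamma <= 0 -> rho_ gamma = extrapolated_radius gamma rho.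
  move=> /andP[gg gamma0]; apply: extrapolated_spectral_radius => //.
  exact: D_ge0.
have optE : rho_ g = 1 - s.
  rewrite part1 ?lexx ?g0 // /extrapolated_radius key subrr !mulr0 addr0.
  have -> : (1 - g) * rho = 2 * (1 - s) by rewrite rhoE; nra.
  by rewrite subrr expr0n sqrtr0 addr0; lra.
split=> // gamma; rewrite optE neq_lt => /orP[gg|gg].
  have r0 : 0 <= rho_ gamma.
    by apply: spectral_radius_ge0; rewrite addn_gt0 n_gt0.
  have := sqr_spectral_radius_ge rhoJ gamma; rewrite -/(rho_ gamma).
  move: (rho_ gamma) r0 => r r0 r2.
  have optsq : (1 - s) ^+ 2 = - g * rho.
    by rewrite rhoE mulrCA mulNr gE; ring.
  have : (1 - s) ^+ 2 < r ^+ 2.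
    by apply: lt_le_trans r2; rewrite optsq ltr_pM2r // ltrN2.
  by rewrite ltr_pXn2r // nnegrE; lra.
apply: (lt_le_trans _ (extrapolated_radius_le_spectral_radius rhoJ (D_ge0 _ (ltW gg)))).
(* The larger root exceeds 1 - s as soon as the square root of the discriminant
   exceeds |2 (1 - s) - b|. *)
rewrite /extrapolated_radius ltr_pdivlMr // mulrC -ltrBlDl.
apply: (le_lt_trans (ler_norm _)); rewrite -sqrtr_sqr ltr_sqrt.
  by rewrite key ltrDl !mulr_gt0 //; lra.
rewrite key ltr_wpDl ?sqr_ge0 // mulr_gt0 //.
by apply: mulr_gt0; lra.
Qed.

(** * Contractions of a symmetric tensor *)

Lemma take1_tuple (T : eqType) (m : nat) (t : m.+1.-tuple T) (a : T) :
  (take 1 t == [tuple a] :> seq T) = (tnth t ord0 == a).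
Proof. by case/tupleP: t => b t; rewrite /= take0 eqseq_cons andbT. Qed.

Lemma take2_tuple (T : eqType) (m : nat) (t : m.+2.-tuple T) (a b : T) :
  (take 2 t == [tuple a; b] :> seq T) =
    (tnth t ord0 == a) && (tnth t (lift ord0 ord0) == b).
Proof.
by case/tupleP: t => c t; case/tupleP: t => d t; rewrite /= take0 !eqseq_cons andbT.
Qed.

(** Sorting the index tuples by their second entry: that entry is free in the
    vector A x^(m-1) and is summed over by the matrix-vector product. *)
Lemma contract_mx_mul (R : realType) (m n : nat) (A : tensor R m n)
    (x : 'cV[R]_n) : (2 <= m)%N -> contract_mx A x *m x = contract_vec A x.
Proof.
case: m A => [|[|m]] // A _; apply/colP => i; rewrite !mxE /contract.
rewrite [RHS](partition_big (fun t => tnth t (lift ord0 ord0)) predT) //=.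
apply: eq_bigr => j _; rewrite mxE /contract mulr_suml.
apply: eq_big => [t|t]; first by rewrite take1_tuple take2_tuple.
rewrite take2_tuple => /andP[_ /eqP <-].
rewrite [in RHS](bigD1 (lift ord0 ord0)) //= -mulrA; congr (_ * _).
rewrite mulrC; congr (_ * _).
by apply: eq_bigl => k; rewrite -val_eqE /=; case: k => [[|[|k]]].
Qed.

(** Exchanging the first two entries of the index tuples leaves A unchanged and
    does not move the entries that are contracted with x. *)
Lemma contract_mx_sym (R : realType) (m n : nat) (A : tensor R m n)
    (x : 'cV[R]_n) : (2 <= m)%N -> symmetric_tensor A ->
  (contract_mx A x)^T = contract_mx A x.
Proof.
case: m A => [|[|m]] // A _ symA; apply/matrixP => i j; rewrite !mxE /contract.
pose s : 'S_m.+2 := tperm ord0 (lift ord0 ord0).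
pose f (t : m.+2.-tuple 'I_n) := [tuple tnth t (s k) | k < m.+2].
have fK : involutive f.
  by move=> t; apply: eq_from_tnth => k; rewrite /f !tnth_mktuple tpermK.
rewrite (reindex_inj (inv_inj fK)); apply: eq_big => [t|t _].
  by rewrite !take2_tuple /f !tnth_mktuple tpermL tpermR andbC.
rewrite symA; congr (_ * _); apply: eq_bigr => k k2; rewrite /f tnth_mktuple.
by rewrite tpermD // -val_eqE /=; case: k k2 => [[|[|k]]].
Qed.

Lemma sphere_norm_entry (R : realType) (n : nat) (x : 'cV[R]_n) (i : 'I_n) :
  x^T *m x = 1%:M -> `|x i 0| <= 1.
Proof.
move=> /matrixP/(_ 0 0); rewrite !mxE eqxx mulr1n (bigD1 i) //= mxE -expr2 => e.
rewrite -(ler_pXn2r (n:=2)) ?nnegrE // real_normK ?num_real // expr1n -e lerDl.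
by apply: sumr_ge0 => k _; rewrite mxE -expr2 sqr_ge0.
Qed.

Lemma contract_norm_le (R : realType) (m n r : nat) (A : tensor R m n)
    (x : 'cV[R]_n) (t : r.-tuple 'I_n) :
  x^T *m x = 1%:M -> `|contract A x t| <= \sum_u `|A u|.
Proof.
move=> x1; rewrite /contract; apply: (le_trans (ler_norm_sum _ _ _)).
rewrite [leRHS](bigID (fun u : m.-tuple 'I_n => take r u == t)) /=.
apply: ler_wpDr; first exact: sumr_ge0.
apply: ler_sum => u _; rewrite normrM ler_piMr // normr_prod.
apply: prodr_ile1 => k _; rewrite normr_ge0 /=.
exact: sphere_norm_entry.
Qed.

(** The entries of A y^(m-2) are bounded uniformly in the unit vector y, so the
    supremum in beta is over a bounded set and dominates its members. *)
Lemma eigenvalue_le_beta (R : realType) (m n : nat) (A : tensor R m n)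
    (x : 'cV[R]_n) (mu : R) : x^T *m x = 1%:M ->
  eigenvalue (contract_mx A x) mu -> (m - 1)%:R * `|mu| <= beta A.
Proof.
move=> x1 ev; apply: ler_wpM2l => //.
apply: (le_trans (real_le_spectral_radius ev)); apply: ub_le_sup; last first.
  by exists x.
exists (\sum_(i < n) \sum_(j < n) \sum_u `|A u|) => _ [y y1 <-].
have n_gt0 : (0 < n)%N.
  case: n A x mu x1 ev y y1 => // A x mu /matrixP/(_ 0 0).
  by rewrite !mxE big_ord0 eqxx => /esym/eqP; rewrite oner_eq0.
apply: spectral_radius_le => // z /eigenvalue_normc_le_entries /le_trans.
apply; apply: ler_sum => i _; apply: ler_sum => j _.
by rewrite mxE contract_norm_le.
Qed.

(** * The spectrum of the Jacobian *)

Lemma perp_coordinates (R : realType) (n : nat) (x : 'cV[R]_n)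
    (U : 'M[R]_(n, n - 1)) (v : 'rV[R]_n) :
  orthonormal_basis_of_perp x U -> v *m x = 0 -> exists w, v = w *m U^T.
Proof.
move=> [_ /andP[_ xU]] vx; apply/submxP.
by apply: submx_trans xU; apply/sub_kermxP.
Qed.

(** The compression U^T S U is symmetric of positive size, so it has a real
    eigenvector w.  The vector w U^T is an eigenvector of S because its defect
    w U^T S - a w U^T is orthogonal to x and to the columns of U. *)
Lemma perp_eigenvector_exists (R : realType) (n : nat) (x : 'cV[R]_n)
    (U : 'M[R]_(n, n - 1)) (S : 'M[R]_n) : (2 <= n)%N ->
  orthonormal_basis_of_perp x U -> S^T = S -> S *m x = 0 ->
  exists (a : R) (v : 'rV[R]_n), [/\ v != 0, v *m x = 0 & v *m S = a *: v].
Proof.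
move=> n2 hU symS Sx; have [UU /andP[Ux _]] := hU.
pose C := U^T *m S *m U.
have symC : C^T = C by rewrite /C !trmx_mul trmxK symS mulmxA.
have n1 : (0 < n - 1)%N by rewrite subn_gt0.
have [z ev] := eigenvalue_closed (map_mx (real_complex R) C) n1.
have [a _ /eigenvalueP[w wC w0]] := symmetric_eigenvalue_real symC ev.
have vx : w *m U^T *m x = 0.
  by rewrite -mulmxA (sub_kermxP Ux) mulmx0.
exists a, (w *m U^T); split=> //.
  by apply: contraNneq w0 => v0; rewrite -[w]mulmx1 -UU mulmxA v0 mul0mx.
apply/subr0_eq; set d := _ - _.
have dx : d *m x = 0.
  by rewrite mulmxBl -scalemxAl vx scaler0 subr0 -mulmxA Sx mulmx0.
have [w' dE] := perp_coordinates hU dx.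
suff w'0 : w' = 0 by rewrite dE w'0 mul0mx.
rewrite -[w']mulmx1 -UU mulmxA -dE mulmxBl -scalemxAl -[w *m U^T *m U]mulmxA UU.
by rewrite mulmx1 -wC /C !mulmxA subrr.
Qed.

(** At an eigenvector w U^T of H, the quadratic form of the projected Hessian
    is (mu - lambda) times a squared length, so its definiteness compares mu
    with lambda. *)
Lemma projected_form (R : realType) (n : nat) (H : 'M[R]_n)
    (U : 'M[R]_(n, n - 1)) (w : 'rV[R]_(n - 1)) (lambda mu : R) :
  w *m U^T *m H = mu *: (w *m U^T) ->
  (w^T^T *m (U^T *m (H - lambda%:M) *m U) *m w^T) 0 0
    = (mu - lambda) * ((w *m U^T) *m (w *m U^T)^T) 0 0.
Proof.
move=> e; rewrite trmxK trmx_mul trmxK !mulmxA mulmxBr e mul_mx_scalar -scalerBl.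
by rewrite -!scalemxAl mxE.
Qed.

Section JacobianSpectrum.
Variables (R : realType) (m n : nat) (A : tensor R m n) (lambda alpha : R).
Variable x : 'cV[R]_n.
Hypotheses (hm : (2 <= m)%N) (hn : (2 <= n)%N) (symA : symmetric_tensor A).
Hypothesis hx : Z_eigenpair A lambda x.
Hypothesis hstable : (beta A < alpha /\ negative_stable A lambda x) \/
               (alpha < - beta A /\ positive_stable A lambda x).

Let M := contract_mx A x.
Let J := jacobian A lambda x alpha.
Let k : R := (m - 1)%:R.

Lemma contract_mx_eigenvector : M *m x = lambda *: x.
Proof. by rewrite contract_mx_mul //; case: hx. Qed.

Lemma jacobian_sym : J^T = J.
Proof.
have trZ c (B : 'M[R]_n) : (c *: B)^T = c *: B^T by rewrite linearZ.
have trN (B : 'M[R]_n) : (- B)^T = - B^T by rewrite linearN.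
have trD (B C : 'M[R]_n) : (B + C)^T = B^T + C^T by rewrite linearD.
by rewrite /J /jacobian !(trZ, trD, trN) trmx_mul trmxK trmx1 contract_mx_sym.
Qed.

Lemma jacobian_kernel : J *m x = 0.
Proof.
have [_ x1] := hx; rewrite /J /jacobian -scalemxAl mulmxDl -!scalemxAl !mulmxBl.
rewrite -scalemxAl -mulmxA x1 mulmx1 mul1mx subrr.
by rewrite contract_mx_eigenvector subrr !scaler0 addr0 scaler0.
Qed.

Lemma row_mul_jacobian (v : 'rV[R]_n) : v *m x = 0 ->
  v *m J = (lambda + alpha)^-1 *: (v *m (k *: M) + alpha *: v).
Proof.
move=> vx; rewrite /J /jacobian -scalemxAr mulmxDr -!scalemxAr !mulmxBr.
by rewrite -scalemxAr !mulmxA vx mul0mx scaler0 !subr0 mulmx1.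
Qed.

Lemma lambda_le_beta : `|lambda| <= beta A.
Proof.
have [_ x1] := hx.
have ev : eigenvalue M lambda.
  apply/eigenvalueP; exists x^T.
    rewrite -[LHS]trmxK trmx_mul trmxK contract_mx_sym //.
    by rewrite contract_mx_eigenvector linearZ.
  apply/eqP => x0; have /matrixP/(_ 0 0)/eqP := x1.
  by rewrite x0 mul0mx !mxE eqxx eq_sym oner_eq0.
apply: le_trans (eigenvalue_le_beta x1 ev); rewrite ler_peMl //.
by rewrite ler1n subn_gt0.
Qed.

(** Since |mu| and |lambda| are at most beta < |alpha|, both mu + alpha and
    lambda + alpha have the sign of alpha.  Negative stability gives
    mu < lambda when alpha is positive, and positive stability gives
    lambda < mu when alpha is negative: in both cases mu + alpha is the one
    of smaller modulus. *)
Lemma perp_eigenvalue_stable (v : 'rV[R]_n) (mu : R) :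
  v != 0 -> v *m x = 0 -> v *m (k *: M) = mu *: v ->
  0 < (mu + alpha) / (lambda + alpha) < 1.
Proof.
move=> v0 vx vH; have [_ x1] := hx.
have k1 : 1 <= k by rewrite ler1n subn_gt0.
have k0 : k != 0 by rewrite gt_eqF // (lt_le_trans ltr01).
have muB : `|mu| <= beta A.
  have ev : eigenvalue M (mu / k).
    apply/eigenvalueP; exists v => //.
    by rewrite mulrC -scalerA -vH -scalemxAr scalerA mulVf // scale1r.
  have := eigenvalue_le_beta x1 ev; rewrite -/k.
  by rewrite -[X in X * _](ger0_norm (le_trans ler01 k1)) -normrM mulrC mulfVK.
have form U : orthonormal_basis_of_perp x U -> exists2 y : 'cV[R]_(n - 1), y != 0 &
    exists2 q, 0 < q &
     (y^T *m projected_hessian A lambda x U *m y) 0 0 = (mu - lambda) * q.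
  move=> hU; have [w vw] := perp_coordinates hU vx.
  exists w^T.
    by apply: contraNneq v0 => w0; rewrite vw -[w]trmxK w0 trmx0 mul0mx.
  exists ((v *m v^T) 0 0); first by rewrite lt_neqAle eq_sym dotmx_eq0 v0 dotmx_ge0.
  by rewrite vw; apply: projected_form; rewrite -vw.
have := lambda_le_beta; move: muB; rewrite !ler_norml.
move=> /andP[mu1 mu2] /andP[la1 la2].
case: hstable => -[hab [U hU hdef]]; have [y y0 [q q0 e]] := form U hU;
  have := hdef y y0; rewrite e.
  rewrite pmulr_llt0 // => lt.
  by rewrite divr_gt0 /= ?ltr_pdivrMr; lra.
rewrite pmulr_lgt0 // => lt.
by rewrite -mulrNN -invrN divr_gt0 /= ?ltr_pdivrMr; lra.
Qed.

Lemma jacobian_perp_eigenvalue (v : 'rV[R]_n) (sigma : R) :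
  v != 0 -> v *m x = 0 -> v *m J = sigma *: v -> 0 < sigma < 1.
Proof.
have la0 : lambda + alpha != 0.
  have := lambda_le_beta; rewrite ler_norml => /andP[la1 la2].
  by case: hstable => -[hab _]; lra.
move=> v0 vx; rewrite row_mul_jacobian // => vJ.
have vH : v *m (k *: M) = (sigma * (lambda + alpha) - alpha) *: v.
  rewrite scalerBl mulrC -scalerA -vJ scalerA mulfV // scale1r.
  by rewrite addrK.
by have := perp_eigenvalue_stable v0 vx vH; rewrite subrK mulfK.
Qed.

(** An eigenvector for a nonzero eigenvalue is orthogonal to the kernel vector
    x of the symmetric matrix J. *)
Lemma jacobian_spectrum (z : R[i]) :
  eigenvalue (map_mx (real_complex R) J) z ->
  exists2 sigma : R, z = (sigma%:C)%C & 0 <= sigma < 1.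
Proof.
case/(symmetric_eigenvalue_real jacobian_sym) => a -> /eigenvalueP[v vJ v0].
exists a => //; have [->|a0] := eqVneq a 0; first by rewrite lexx ltr01.
suff vx : v *m x = 0.
  by have /andP[/ltW -> ->] := jacobian_perp_eigenvalue v0 vx vJ.
by apply: (scalerI a0); rewrite scalemxAl -vJ -mulmxA jacobian_kernel mulmx0 scaler0.
Qed.

Lemma jacobian_positive_eigenvalue :
  exists2 a : R, 0 < a & eigenvalue J a.
Proof.
have [U hU] : exists U, orthonormal_basis_of_perp x U.
  by case: hstable => -[_ [U hU _]]; exists U.
have [a [v [v0 vx vJ]]] :=
  perp_eigenvector_exists hn hU jacobian_sym jacobian_kernel.
exists a; last by apply/eigenvalueP; exists v.
by have /andP[] := jacobian_perp_eigenvalue v0 vx vJ.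
Qed.

End JacobianSpectrum.

Theorem theorem3p5 (R : realType) (m n : nat) (hm : (2 <= m)%N)
    (hn : (2 <= n)%N) (A : tensor R m n) (hA : symmetric_tensor A)
    (lambda : R) (x : 'cV[R]_n) (hx : Z_eigenpair A lambda x) (alpha : R)
    (hstable : (beta A < alpha /\ negative_stable A lambda x) \/
               (alpha < - beta A /\ positive_stable A lambda x)) :
  let J := jacobian A lambda x alpha in
  let rho := spectral_radius J in
  let rho_ := fun gamma : R => spectral_radius (extrapolated_jacobian J gamma) in
  let gamma_opt := ((rho - 2) + 2 * Num.sqrt (1 - rho)) / rho in
  [/\ forall gamma : R, gamma_opt <= gamma <= 0 ->
        rho_ gamma =
          ((1 - gamma) * rho
           + Num.sqrt (((1 - gamma) * rho) ^+ 2 + 4 * gamma * rho)) / 2,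
      forall gamma : R, gamma != gamma_opt -> rho_ gamma_opt < rho_ gamma
    & rho_ gamma_opt = 1 - Num.sqrt (1 - rho)].
Proof.
move=> J rho; have n_gt0 : (0 < n)%N by apply: leq_trans hn.
have spec := @jacobian_spectrum _ _ _ _ _ _ _ hm hA hx hstable.
have [a a0 aJ] := jacobian_positive_eigenvalue hm hn hA hx hstable.
have [z zJ zrho] := spectral_radius_attained J n_gt0.
have [r zr /andP[r0 r1]] := spec z zJ.
have rE : r = rho by rewrite /rho -zrho zr normc_real ger0_norm.
rewrite {}zr rE (eigenvalue_map (real_complex R)) in zJ.
rewrite rE in r1.
apply: optimal_extrapolation => //.
  rewrite r1 andbT (lt_le_trans a0) // -[leLHS]gtr0_norm //.
  exact: real_le_spectral_radius.
move=> y yJ; have [s ys /andP[s0 s1]] := spec y yJ; exists s => //.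
by rewrite s0 -[leLHS]ger0_norm // -normc_real -ys normc_le_spectral_radius.
Qed.
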